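(* Let $G$ be a simple graph on vertex set $\{1,\ldots,n\}$ and $k\ge 1$ an integer such that $G$ has a non-empty $k$-core, and let $V_{k\text{-core}}$ denote the vertex set of the $k$-core of $G$. Let $\mathbf{x}^{(k)}=(x^{(k)}_1,\ldots,x^{(k)}_n)^{\mathrm T}$ be a Perron eigenvector of $\mathcal{A}^{(k)}(G)$, i.e. a nonzero entrywise nonnegative eigenvector of $\mathcal{A}^{(k)}(G)$ corresponding to the eigenvalue $\rho_k(G)$. Then $\operatorname{supp}(\mathbf{x}^{(k)})\subseteq V_{k\text{-core}}$. Moreover, if the subgraph of $G$ induced by $V_{k\text{-core}}$ is connected, then $\operatorname{supp}(\mathbf{x}^{(k)})=V_{k\text{-core}}$.
   Context: All graphs are finite, simple and undirected. The $k$-core of a graph $G$ is the maximal subgraph of $G$ in which every vertex has degree at least $k$ within the subgraph. For a tensor $\mathcal{A}=(a_{i_1 i_2\cdots i_m})$ of order $m$ and dimension $n$ and $\mathbf{x}\in\mathbb{C}^n$, $\mathcal{A}\mathbf{x}^{m-1}\in\mathbb{C}^n$ has $i$-th component $\sum_{i_2,\ldots,i_m=1}^n a_{i i_2\cdots i_m}x_{i_2}\cdots x_{i_m}$. A complex number $\lambda$ is an eigenvalue of $\mathcal{A}$ if there is a nonzero $\mathbf{x}\in\mathbb{C}^n$ with $\mathcal{A}\mathbf{x}^{m-1}=\lambda\mathbf{x}^{[m-1]}$, where $\mathbf{x}^{[m-1]}=(x_1^{m-1},\ldots,x_n^{m-1})^{\mathrm T}$; $\mathbf{x}$ is then an eigenvector.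 The spectral radius $\rho(\mathcal{A})$ is the largest modulus of the eigenvalues of $\mathcal{A}$. For a graph $G$ on vertex set $\{1,\ldots,n\}$ with neighborhoods $N_G(i)$, the $k$-adjacency tensor $\mathcal{A}^{(k)}(G)=(a_{i_1 i_2\cdots i_{k+1}})$ is the order-$(k+1)$, dimension-$n$ tensor with $a_{i_1 i_2\cdots i_{k+1}}=1/k!$ if $i_1,\ldots,i_{k+1}$ are pairwise distinct and $\{i_2,\ldots,i_{k+1}\}\subseteq N_G(i_1)$, and $0$ otherwise. Equivalently, $(\mathcal{A}^{(k)}(G)\mathbf{x}^k)_i=\sum_{T\subseteq N_G(i),\,|T|=k}\prod_{j\in T}x_j$. Define $\rho_k(G)=\rho(\mathcal{A}^{(k)}(G))$. The support of $\mathbf{x}$ is $\operatorname{supp}(\mathbf{x})=\{i: x_i\neq 0\}$. *)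

(* Defs.v *)
From mathcomp Require Import all_boot all_order all_algebra.
Set Implicit Arguments. Unset Strict Implicit. Unset Printing Implicit Defensive.
Import Order.TTheory GRing.Theory Num.Theory.
Local Open Scope ring_scope.

(* The field of scalars C is an arbitrary numeric algebraically closed field
   (e.g. the complex numbers R[i] over the reals).  A simple graph on the
   vertex set 'I_n (= {1..n} shifted) is a symmetric irreflexive relation. *)

Definition simple_graph (n : nat) (G : rel 'I_n) : Prop :=
  symmetric G /\ irreflexive G.

Definition nbhd (n : nat) (G : rel 'I_n) (i : 'I_n) : {set 'I_n} :=
  [set j | G i j].

(* A tensor of order k+1 and dimension n: entry a_{i i_2 ... i_{k+1}} is
   A i t where t = (i_2,...,i_{k+1}). *)
Definition tensor (C : Type) (n k : nat) := 'I_n -> k.-tuple 'I_n -> C.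

Definition tapply (C : numClosedFieldType) (n k : nat) (A : tensor C n k)
  (x : 'I_n -> C) (i : 'I_n) : C :=
  \sum_(t : k.-tuple 'I_n) A i t * \prod_(j < k) x (tnth t j).

Definition is_eigenpair (C : numClosedFieldType) (n k : nat) (A : tensor C n k)
  (lambda : C) (x : 'I_n -> C) : Prop :=
  (exists i, x i != 0) /\ forall i, tapply A x i = lambda * x i ^+ k.

Definition is_eigenvalue (C : numClosedFieldType) (n k : nat) (A : tensor C n k)
  (lambda : C) : Prop := exists x, is_eigenpair A lambda x.

Definition is_spectral_radius (C : numClosedFieldType) (n k : nat)
  (A : tensor C n k) (r : C) : Prop :=
  (exists lambda, is_eigenvalue A lambda /\ `|lambda| = r) /\
  (forall lambda, is_eigenvalue A lambda -> `|lambda| <= r).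

Definition kadj_tensor (C : numClosedFieldType) (n : nat) (G : rel 'I_n) (k : nat)
  : tensor C n k :=
  fun i t => if uniq (i :: val t) && all (fun j => j \in nbhd G i) (val t)
             then (k`!%:R)^-1 else 0.

Definition min_deg_ge (n : nat) (G : rel 'I_n) (k : nat) (S : {set 'I_n}) : bool :=
  [forall v in S, (k <= #|nbhd G v :&: S|)%N].

(* K is the vertex set of the k-core: the maximal subgraph of minimum degree
   >= k (which is induced, and contains every such subgraph). *)
Definition is_kcore_vertex_set (n : nat) (G : rel 'I_n) (k : nat) (K : {set 'I_n})
  : Prop :=
  min_deg_ge G k K /\ forall S : {set 'I_n}, min_deg_ge G k S -> S \subset K.

Definition induced_connected (n : nat) (G : rel 'I_n) (S : {set 'I_n}) : Prop :=
  forall u v, u \in S -> v \in S ->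
    connect [rel a b | [&& G a b, a \in S & b \in S]] u v.

Definition supp (C : numClosedFieldType) (n : nat) (x : 'I_n -> C) : {set 'I_n} :=
  [set i | x i != 0].

(* Main.v *)
Require Import Defs.
From HB Require Import structures.
From mathcomp Require Import all_boot all_order all_algebra.
From mathcomp Require Import boolp polyrcf ordered_qelim qe_rcf ring lra zify.
Import Order.TTheory GRing.Theory Num.Theory.
Local Open Scope ring_scope.
Set Implicit Arguments. Unset Strict Implicit. Unset Printing Implicit Defensive.

(* The proof works over an arbitrary numClosedFieldType, whose real elements
   need not be complete; the role of completeness and compactness is played by
   the o-minimality of real closed fields (quantifier elimination).

   For a nonnegative tensor A let F x = A x^k, a monotone map homogeneous of
   degree k, and let r be the infimum of the c for which F w < c w^k has a
   positive solution w.  For c > r the equation F w + 1 = c w^k has a least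
   solution w_c, by a Knaster-Tarski argument.  As c decreases to r these
   solutions are unbounded, so w_c / (sum of w_c) converges to a nonnegative
   eigenvector v for the eigenvalue r.  Comparing entries shows that r bounds
   every c having a nonzero z >= 0 with F z >= c z^k.

   Applied to A^(k)(G) and the indicator of the k-core, this gives rho > 0, so
   every vertex of the support of x has k neighbors in the support, which
   therefore lies in the k-core.  If the k-core is connected, applied to the
   tensor restricted to the core, it gives an eigenvector v for rho; a Harnack
   inequality for the w_c makes v positive on the core.  With t the least
   number such that x <= t v, equality holds somewhere on the core and spreads
   along edges, so x = t v. *)

(** * The real elements of [C] as a real closed field *)

Record realsub (C : numClosedFieldType) :=
  RealSub {rval : C; rvalP : rval \is Num.real}.

Section RealSubfield.
Variable C : numClosedFieldType.
Local Notation R := (realsub C).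
Local Notation rv := (@rval C).

HB.instance Definition _ := [isSub for rv].
HB.instance Definition _ := [Choice of R by <:].
HB.instance Definition _ := [SubChoice_isSubIntegralDomain of R by <:].
HB.instance Definition _ := [SubIntegralDomain_isSubField of R by <:].

Definition real_le (x y : R) := rv x <= rv y.
Definition real_lt (x y : R) := rv x < rv y.
Definition real_norm (x : R) : R := RealSub (normr_real (rv x)).

Fact real_le0_add x y : real_le 0 x -> real_le 0 y -> real_le 0 (x + y).
Proof. exact: addr_ge0. Qed.
Fact real_le0_mul x y : real_le 0 x -> real_le 0 y -> real_le 0 (x * y).
Proof. exact: mulr_ge0. Qed.
Fact real_le0_anti x : real_le 0 x -> real_le x 0 -> x = 0.
Proof. by move=> x0 x1; apply/val_inj/le_anti/andP; split. Qed.
Fact real_sub_ge0 x y : real_le 0 (y - x) = real_le x y.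
Proof. exact: subr_ge0. Qed.
Fact real_le0_total x : real_le 0 x || real_le x 0.
Proof. by have := rvalP x; rewrite realE. Qed.
Fact real_normN x : real_norm (- x) = real_norm x.
Proof. exact/val_inj/normrN. Qed.
Fact real_ge0_norm x : real_le 0 x -> real_norm x = x.
Proof. by move=> x0; apply/val_inj/ger0_norm. Qed.
Fact real_lt_def x y : real_lt x y = (y != x) && real_le x y.
Proof. by rewrite /real_lt lt_def. Qed.

HB.instance Definition _ := Num.IntegralDomain_isLeReal.Build R
  real_le0_add real_le0_mul real_le0_anti real_sub_ge0 real_le0_total
  real_normN real_ge0_norm real_lt_def.

Fact rval_zmod : zmod_morphism rv. Proof. by []. Qed.
Fact rval_monoid : monoid_morphism rv. Proof. by []. Qed.
HB.instance Definition _ := GRing.isZmodMorphism.Build R C rv rval_zmod.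
HB.instance Definition _ := GRing.isMonoidMorphism.Build R C rv rval_monoid.

Lemma rval_le (x y : R) : (rv x <= rv y) = (x <= y). Proof. by []. Qed.

(** Induction on the degree. A nonconstant [p] has a root [z] in [C]. If [z] is real it lies outside
    [[a, b]], and [X - z] has the same sign at [a] and [b]; otherwise the real quadratic with roots
    [z] and its conjugate is positive everywhere. In both cases the factor is split off. *)
Lemma noroot_same_sign (p : {poly R}) (a b : R) : a <= b ->
  (forall x, a <= x <= b -> ~~ root p x) -> 0 < p.[a] * p.[b].
Proof.
have [m] := ubnP (size p); elim: m p => // m IHm p ltpm leab nrp.
have [/size1_polyC pE|p_gt1] := leqP (size p) 1.
  have := nrp a; rewrite lexx leab => /(_ isT).
  by rewrite pE rootC !hornerC -expr2 => p0; rewrite exprn_even_gt0 //= p0.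
have p_neq0 : p != 0 by rewrite -size_poly_gt0 ltnW.
have /closed_rootP[z rz] : size (map_poly rv p) != 1%N.
  by rewrite size_map_poly neq_ltn p_gt1 orbT.
have step (q d : {poly R}) : p = q * d -> (1 < size d)%N ->
    0 < d.[a] * d.[b] -> 0 < p.[a] * p.[b].
  move=> pE d_gt1 dpos; rewrite pE !hornerM mulrACA mulr_gt0 //.
  have : (q != 0) && (d != 0) by rewrite -negb_or -mulf_eq0 -pE.
  move=> /andP[q0 d0].
  apply: IHm => // [|x xab]; last first.
    by apply: contra (nrp x xab) => qx; rewrite pE rootM qx.
  have := ltpm; rewrite ltnS pE size_mul // -(subnKC d_gt1) !addnS /= => sz.
  by apply: leq_trans sz; rewrite ltnS leq_addr.
have [zR|zNR] := boolP (z \is Num.real).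
  have rp : root p (RealSub zR) by rewrite -(fmorph_root rv).
  have /factor_theorem[q pE] := rp.
  apply: (step q _ pE); rewrite ?size_XsubC // !hornerXsubC.
  have : ~~ (a <= RealSub zR <= b) by apply/negP=> /nrp; rewrite rp.
  rewrite negb_and -!ltNge => /orP[za|bz].
    by rewrite mulr_gt0 // subr_gt0 // (lt_le_trans za).
  by rewrite -mulrNN mulr_gt0 // !opprB subr_gt0 // (le_lt_trans leab).
pose u := RealSub (Creal_Re z); pose v := RealSub (Creal_Im z).
have v0 : v != 0 by apply: contra zNR => /eqP/(congr1 rv) /= /Creal_ImP.
pose d : {poly R} := ('X - u%:P) ^+ 2 + (v ^+ 2)%:P.
have dE : map_poly rv d = ('X - z%:P) * ('X - z^*%:P).
  rewrite /d rmorphD rmorphXn rmorphB /= map_polyX !map_polyC /=.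
  have zE := Crect z; have zcE : z^* = 'Re z - 'i * 'Im z.
    by rewrite [in LHS]zE conjC_rect ?Creal_Re ?Creal_Im.
  have -> : ('Im z * 'Im z)%:P = - ('i * 'Im z)%:P ^+ 2 :> {poly C}.
    by rewrite -rmorphXn exprMn sqrCi mulN1r rmorphN opprK.
  have -> : z%:P = ('Re z)%:P + ('i * 'Im z)%:P by rewrite -rmorphD -zE.
  rewrite zcE rmorphB /=.
  by move: ('Re z)%:P ('i * 'Im z)%:P => x y; ring.
have dpos x : 0 < d.[x].
  rewrite /d hornerD horner_exp hornerXsubC hornerC.
  by rewrite ltr_wpDl ?exprn_even_ge0 // exprn_even_gt0.
have szd : size d = 3.
  by rewrite -(size_map_poly rv) dE size_mul ?polyXsubC_eq0 // !size_XsubC.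
(* The coefficients of [p] are real, so the conjugate of [z] is a root too; the two linear factors
   are coprime because [z] is not real. *)
have /dvdpP[q pE] : d %| p.
  rewrite -(dvdp_map rv) dE Gauss_dvdp; last first.
    rewrite coprimep_XsubC root_XsubC; apply: contra zNR.
    by rewrite CrealE eq_sym.
  have pc : map_poly Num.conj (map_poly rv p) = map_poly rv p.
    rewrite -map_poly_comp; apply: eq_map_poly => x /=.
    by rewrite conj_Creal ?rvalP.
  by rewrite !dvdp_XsubCl rz -pc fmorph_root rz.
by apply: (step q _ pE); rewrite ?szd // mulr_gt0.
Qed.

Fact realsub_closed : Num.real_closed_axiom R.
Proof.
move=> p a b leab /andP[pa pb].
have [[x /andP[xab rx]]|nrp] := pselect (exists x, (a <= x <= b) && root p x).
  by exists x.
have : p.[a] * p.[b] <= 0 by rewrite mulr_le0_ge0.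
rewrite leNgt noroot_same_sign // => x xab.
by apply/negP => rx; apply: nrp; exists x; rewrite xab.
Qed.
HB.instance Definition _ := Num.RealField_isClosed.Build R realsub_closed.

End RealSubfield.

(** * O-minimality: definable subsets of the line are tame *)

Section Tame.
Variable R : rcfType.

(* Points of [s] are break points: [D] is a finite union of points and
   intervals with end points in [s]. *)
Definition tame (D : R -> Prop) := exists s : seq R, forall a b, a <= b ->
  (forall x, x \in s -> ~~ (a <= x <= b)) -> (D a <-> D b).

Lemma tame_not D : tame D -> tame (fun x => ~ D x).
Proof. by move=> [s sP]; exists s => a b ab /(sP a b ab) H; split; tauto. Qed.

Lemma tame_op (op : Prop -> Prop -> Prop) D E :
  (forall P P' Q Q', (P <-> P') -> (Q <-> Q') -> op P Q <-> op P' Q') ->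
  tame D -> tame E -> tame (fun x => op (D x) (E x)).
Proof.
move=> opP [s sP] [t tP]; exists (s ++ t) => a b ab st.
by apply: opP; [apply: sP|apply: tP] => // x xs; apply: st;
  rewrite mem_cat xs ?orbT.
Qed.

Lemma tame_sgr (p : {poly R}) (Q : R -> bool) :
  tame (fun x => Q (Num.sg p.[x])).
Proof.
exists (rootsR p) => a b ab nr.
have [->|p0] := eqVneq p 0; first by rewrite !horner0.
suff -> : Num.sg p.[a] = Num.sg p.[b] by [].
apply: (@polyrN0_itv _ `[a, b]); rewrite ?in_itv /= ?lexx ?ab // => x.
rewrite in_itv /= => xab; apply/negP => rx.
by have := nr x; rewrite -(roots_on_rootsR p0) rx xab => /(_ isT).
Qed.

(** [rterm] excludes inverses; with all variables but the one of index [i] fixed, what remains is a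
    polynomial. *)
Lemma eval_horner (t : GRing.term R) (e : seq R) i : GRing.rterm t ->
  exists p : {poly R}, forall x, GRing.eval (set_nth 0 e i x) t = p.[x].
Proof.
elim: t => //=.
- move=> j _; have [->|ji] := eqVneq j i.
    by exists 'X => x; rewrite hornerX nth_set_nth /= eqxx.
  by exists (e`_j)%:P => x; rewrite hornerC nth_set_nth /= (negbTE ji).
- by move=> c _; exists c%:P => x; rewrite hornerC.
- by move=> n _; exists n%:R%:P => x; rewrite hornerC.
- move=> t IHt u IHu /andP[/IHt[p pE] /IHu[q qE]].
  by exists (p + q) => x; rewrite hornerD pE qE.
- by move=> t IHt /IHt[p pE]; exists (- p) => x; rewrite hornerN pE.
- by move=> t IHt n /IHt[p pE]; exists (p *+ n) => x; rewrite hornerMn pE.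
- move=> t IHt u IHu /andP[/IHt[p pE] /IHu[q qE]].
  by exists (p * q) => x; rewrite hornerM pE qE.
- by move=> t IHt n /IHt[p pE]; exists (p ^+ n) => x; rewrite horner_exp pE.
Qed.

Lemma eq_tame (D E : R -> Prop) : (forall x, D x <-> E x) -> tame D -> tame E.
Proof. by move=> DE; have -> : D = E by apply/funext => x; apply/propext. Qed.

(** An atom comparing two terms depends only on the sign of a polynomial, their difference;
    connectives merge the break points. *)
Lemma tame_qf (f : ord.formula R) (e : seq R) i :
  ord.qf_form f && ord.rformula f ->
  tame (fun x => ord.holds (set_nth 0 e i x) f).
Proof.
have atom (Q : R -> bool) (D : R -> R -> Prop) t u :
    (forall x y, Q (Num.sg (x - y)) <-> D x y) ->
    GRing.rterm t && GRing.rterm u ->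
    tame (fun x =>
      D (GRing.eval (set_nth 0 e i x) t) (GRing.eval (set_nth 0 e i x) u)).
  move=> QD /andP[rt ru].
  have [p pE] := eval_horner e i rt; have [q qE] := eval_horner e i ru.
  apply: eq_tame (tame_sgr (p - q) Q) => x.
  by rewrite pE qE hornerD hornerN.
elim: f => //=.
- by move=> b _; exists [::].
- move=> t u /(atom (fun x => x == 0) (fun x y => x = y)); apply => x y.
  by rewrite sgr_eq0 subr_eq0; split => /eqP.
- move=> t u /(atom (fun x => x < 0) (fun x y => x < y)); apply => x y.
  by rewrite sgr_lt0 subr_lt0.
- move=> t u /(atom (fun x => x <= 0) (fun x y => x <= y)); apply => x y.
  by rewrite sgr_le0 subr_le0.
- move=> f IHf g IHg; rewrite andbACA => /andP[/IHf Df /IHg Dg].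
  by apply: (tame_op (op := and)) => //; tauto.
- move=> f IHf g IHg; rewrite andbACA => /andP[/IHf Df /IHg Dg].
  by apply: (tame_op (op := or)) => //; tauto.
- move=> f IHf g IHg; rewrite andbACA => /andP[/IHf Df /IHg Dg].
  by apply: (tame_op (op := fun P Q => P -> Q)) => //; tauto.
- by move=> f IHf /IHf/tame_not.
Qed.

(** [to_rform] removes the inverses, then quantifier elimination reduces to the quantifier-free
    case. *)
Lemma tame_formula (f : ord.formula R) (e : seq R) i :
  tame (fun x => ord.holds (set_nth 0 e i x) f).
Proof.
have rf := ord.to_rform_rformula f.
have gP := ord.quantifier_elim_wf (@wf_QE_wproj R) rf.
have qeP e' := ord.quantifier_elim_rformP
  (@wf_QE_wproj R) (@valid_QE_wproj R) e' rf.
apply: eq_tame (tame_qf e i gP) => x; have [gf _] := andP gP.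
split; first by move=> /(ord.qf_evalP _ gf)/qeP/ord.to_rformP.
by move=> /ord.to_rformP/qeP/(ord.qf_evalP _ gf).
Qed.
End Tame.

(** * Definable predicates, and cuts and one-sided behavior of tame sets *)

Section Definable.
Variable R : rcfType.
Implicit Types (P Q : (nat -> R) -> Prop) (g h : (nat -> R) -> R).

(* Variables are valued by functions [nat -> R], rather than by the finite
   sequences of [ord.holds], so that [P] can be any predicate on them. *)
Definition definable P :=
  exists f : ord.formula R, forall e, ord.holds e f <-> P (nth 0 e).
Definition termfun g :=
  exists t : GRing.term R, forall e, GRing.eval e t = g (nth 0 e).

Definition override (s : seq nat) (v w : nat -> R) :=
  fun j => if j \in s then w j else v j.

Lemma termfun_var i : termfun (fun v => v i).
Proof. by exists (GRing.Var _ i). Qed.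

Lemma termfun_const c : termfun (fun=> c).
Proof. by exists (GRing.Const c). Qed.

Lemma termfunD g h : termfun g -> termfun h -> termfun (fun v => g v + h v).
Proof.
by move=> [t tE] [u uE]; exists (GRing.Add t u) => e /=; rewrite tE uE.
Qed.

Lemma termfunM g h : termfun g -> termfun h -> termfun (fun v => g v * h v).
Proof.
by move=> [t tE] [u uE]; exists (GRing.Mul t u) => e /=; rewrite tE uE.
Qed.

Lemma termfunX g n : termfun g -> termfun (fun v => g v ^+ n).
Proof. by move=> [t tE]; exists (GRing.Exp t n) => e /=; rewrite tE. Qed.

Lemma termfun_sum (I : Type) (r : seq I) (g : I -> (nat -> R) -> R) :
  (forall i, termfun (g i)) -> termfun (fun v => \sum_(i <- r) g i v).
Proof.
move=> gT; elim: r => [|i r [t tE]].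
  by have [t tE] := termfun_const 0; exists t => e; rewrite tE big_nil.
have [u uE] := gT i; exists (GRing.Add u t) => e /=.
by rewrite big_cons uE tE.
Qed.

Lemma termfun_prod (I : Type) (r : seq I) (g : I -> (nat -> R) -> R) :
  (forall i, termfun (g i)) -> termfun (fun v => \prod_(i <- r) g i v).
Proof.
move=> gT; elim: r => [|i r [t tE]].
  by have [t tE] := termfun_const 1; exists t => e; rewrite tE big_nil.
have [u uE] := gT i; exists (GRing.Mul u t) => e /=.
by rewrite big_cons uE tE.
Qed.

Lemma definable_le g h : termfun g -> termfun h ->
  definable (fun v => g v <= h v).
Proof. by move=> [t tE] [u uE]; exists (ord.Le t u) => e /=; rewrite tE uE. Qed.

Lemma definable_lt g h : termfun g -> termfun h ->
  definable (fun v => g v < h v).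
Proof. by move=> [t tE] [u uE]; exists (ord.Lt t u) => e /=; rewrite tE uE. Qed.

Lemma definable_and P Q :
  definable P -> definable Q -> definable (fun v => P v /\ Q v).
Proof.
by move=> [f fE] [g gE]; exists (ord.And f g) => e /=; rewrite fE gE.
Qed.

Lemma definable_imp P Q :
  definable P -> definable Q -> definable (fun v => P v -> Q v).
Proof.
by move=> [f fE] [g gE]; exists (ord.Implies f g) => e /=; rewrite fE gE.
Qed.

Lemma definable_not P : definable P -> definable (fun v => ~ P v).
Proof. by move=> [f fE]; exists (ord.Not f) => e /=; rewrite fE. Qed.

Lemma eq_definable P Q : (forall v, P v <-> Q v) -> definable P -> definable Q.
Proof. by move=> PQ [f fE]; exists f => e; rewrite fE. Qed.

Lemma definable_all (I : finType) (P : I -> (nat -> R) -> Prop) :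
  (forall i, definable (P i)) -> definable (fun v => forall i, P i v).
Proof.
move=> Pd.
suff gen (r : seq I) : definable (fun v => forall i, i \in r -> P i v).
  have [f fE] := gen (index_enum I); exists f => e; rewrite fE.
  split=> [H i|H i _]; last exact: H.
  by apply: (H i); rewrite mem_index_enum.
elim: r => [|j r IHr].
  by exists (ord.Bool true) => e; split.
apply: eq_definable (definable_and (Pd j) IHr) => v; split.
  by move=> [Pj Pr] i; rewrite inE => /predU1P[->|/Pr].
move=> H; split; first by apply: H; rewrite mem_head.
by move=> i ir; apply: H; rewrite inE ir orbT.
Qed.

Lemma nth_set_nth_override e i x :
  nth 0 (set_nth 0 e i x) = override [:: i] (nth 0 e) (fun=> x).
Proof.
by apply/funext => j; rewrite nth_set_nth /override inE /=.
Qed.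

Lemma definable_exists s P :
  definable P -> definable (fun v => exists w, P (override s v w)).
Proof.
elim: s P => [|i s IHs] P Pd.
  apply: eq_definable Pd => v; split=> [Pv|[w]].
    by exists v; rewrite (_ : override _ _ _ = v) //; apply/funext.
  by rewrite (_ : override _ _ _ = v) //; apply/funext.
have [f fE] := IHs P Pd; exists (ord.Exists i f) => e /=; split.
  move=> [x /fE]; rewrite nth_set_nth_override => -[w Pw].
  (* If [i] also occurs in [s], the inner quantifier rebinds it, so [w] takes precedence over
     [x]. *)
  exists (fun j => if j \in s then w j else x).
  congr (P _): Pw; apply/funext => j; rewrite /override !inE.
  by case: (j \in s); rewrite ?orbT ?orbF.
move=> [w Pw]; exists (w i); apply/fE; rewrite nth_set_nth_override; exists w.
congr (P _): Pw; apply/funext => j; rewrite /override !inE.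
by case: (j \in s); rewrite ?orbT ?orbF //; case: eqP => [->|].
Qed.

Lemma tame_definable P i v : definable P ->
  tame (fun x => P (override [:: i] (nth 0 v) (fun=> x))).
Proof.
move=> [f fE]; apply: eq_tame (tame_formula f v i) => x.
by rewrite fE nth_set_nth_override.
Qed.

(* Replaces compactness when passing to the limit at [r]. *)
Lemma tame_eventually (D : R -> Prop) r : tame D ->
  (exists2 d, 0 < d & forall c, r < c < r + d -> D c) \/
  (exists2 d, 0 < d & forall c, r < c < r + d -> ~ D c).
Proof.
move=> [s sP].
(* No break point lies strictly between [r] and [r + d], so the truth value of [D] is constant there
   and can be read off at the midpoint. *)
have [d d0 dP] : exists2 d, 0 < d & forall x, x \in s -> r < x -> r + d <= x.
  elim: s {sP} => [|y s [d d0 dP]]; first by exists 1.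
  exists (Num.min d (if r < y then y - r else 1)).
    rewrite lt_min d0 /=.
    by case: ifP; rewrite ?subr_gt0.
  move=> x; rewrite inE => /predU1P[-> ry|/dP H /H].
    by rewrite ry -lerBrDl ge_min lexx orbT.
  by rewrite -!lerBrDl ge_min => ->.
have con a b : r < a < r + d -> r < b < r + d -> D a -> D b.
  move=> /andP[ra ad] /andP[rb bd].
  have nos x y : r < x -> y < r + d -> forall z, z \in s -> ~~ (x <= z <= y).
    move=> rx yd z zs; apply/negP => /andP[xz zy].
    by have := dP _ zs (lt_le_trans rx xz); rewrite leNgt (le_lt_trans zy yd).
  have [ab|/ltW ba] := leP a b.
    by rewrite (sP a b ab (nos _ _ ra bd)).
  by rewrite (sP b a ba (nos _ _ rb ad)).
have mid : r < r + d / 2 < r + d by apply/andP; split; lra.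
have [Dm|nDm] := pselect (D (r + d / 2)); [left|right]; exists d => // c rcd.
  exact: con Dm.
by move=> /(con _ _ rcd mid).
Qed.

(* Replaces completeness. *)
Lemma tame_cut (D : R -> Prop) : tame D ->
  (forall a b, a <= b -> D a -> D b) -> (exists a, ~ D a) -> (exists b, D b) ->
  exists m, (forall t, m < t -> D t) /\ (forall t, t < m -> ~ D t).
Proof.
move=> [s sP] up exa exb; apply: contrapT => nocut.
suff [a [b [nDa Db ab]]] : exists a b,
    [/\ ~ D a, D b & forall x, x \in s -> x < a \/ b < x].
  have leab : a <= b by rewrite leNgt; apply/negP => /ltW/up/(_ Db).
  apply: nDa; apply/(sP a b leab) => // x /ab[];
    rewrite negb_and -!ltNge => ->//.
  by rewrite orbT.
(* The break points are expelled one at a time: a point above [x] where [D] fails allows raising [a]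
   past [x], a point below [x] where [D] holds allows lowering [b] past it. If there is neither, [x]
   itself is a cut. *)
elim: s {sP} => [|x s [a [b [nDa Db ab]]]].
  by have [[a ?] [b ?]] := (exa, exb); exists a, b.
have [[t [xt nDt]]|H1] := pselect (exists t, x < t /\ ~ D t).
  have [at_|ta] := leP a t.
    exists t, b; split=> // y; rewrite inE => /predU1P[->|/ab[ya|]];
      [by left| |by right].
    by left; apply: lt_le_trans at_.
  exists a, b; split=> // y; rewrite inE => /predU1P[->|/ab //].
  left; exact: lt_trans ta.
have [[t [tx Dt]]|H2] := pselect (exists t, t < x /\ D t).
  have [tb|bt] := leP t b.
    exists a, t; split=> // y; rewrite inE => /predU1P[->|/ab[ya|yb]];
      [by right|by left|].
    by right; apply: le_lt_trans yb.
  exists a, b; split=> // y; rewrite inE => /predU1P[->|/ab //].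
  right; exact: lt_trans bt tx.
case: nocut; exists x; split=> t.
  by move=> xt; apply: contrapT => nDt; apply: H1; exists t.
by move=> tx Dt; apply: H2; exists t.
Qed.
End Definable.

(** * Quantification over vectors *)

Section DefinableFamilies.
Variable R : rcfType.
Implicit Types (P : (nat -> R) -> Prop).

Definition assign (I : finType) (off : I -> nat) (v : nat -> R) (w : I -> R) :=
  fun j => if [pick i | off i == j] is Some i then w i else v j.

Lemma assign_in (I : finType) (off : I -> nat) v w i :
  injective off -> assign off v w (off i) = w i.
Proof.
move=> inj; rewrite /assign; case: pickP => [j /eqP/inj -> //|/(_ i)].
by rewrite eqxx.
Qed.

Lemma assignK (I : finType) (off : I -> nat) v w :
  injective off -> (fun i => assign off v w (off i)) = w.
Proof. by move=> inj; apply/funext => i; apply: assign_in. Qed.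

Lemma assign_out (I : finType) (off : I -> nat) v w j :
  (forall i, off i != j) -> assign off v w j = v j.
Proof.
by move=> nj; rewrite /assign; case: pickP => // i; rewrite (negbTE (nj i)).
Qed.

(** [P] reads the coordinates of the vector from the variables [off i], while [Q] takes the vector
    as an argument; the quantifier over [w] becomes one quantifier per variable. *)
Lemma definable_ex (I : finType) (off : I -> nat) P
    (Q : (nat -> R) -> (I -> R) -> Prop) : injective off ->
  (forall v w, P (assign off v w) <-> Q v w) ->
  definable P -> definable (fun v => exists w, Q v w).
Proof.
move=> inj PQ /(definable_exists (codom off)); apply: eq_definable => v; split.
  move=> [w Pw]; exists (w \o off); apply/PQ; congr (P _): Pw.
  apply/funext => j; rewrite /override /assign; case: pickP => [i /eqP <-|nj].
    by rewrite codom_f.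
  by case: ifP => // /codomP[i jE]; have := nj i; rewrite jE eqxx.
move=> [w /PQ Pw]; exists (assign off v w); congr (P _): Pw.
apply/funext => j; rewrite /override; case: ifP => // /negbT nj.
by rewrite assign_out // => i; apply: contra nj => /eqP <-; apply: codom_f.
Qed.

Lemma definable_fa (I : finType) (off : I -> nat) P
    (Q : (nat -> R) -> (I -> R) -> Prop) : injective off ->
  (forall v w, P (assign off v w) <-> Q v w) ->
  definable P -> definable (fun v => forall w, Q v w).
Proof.
move=> inj PQ /definable_not Pd.
have := @definable_ex _ off _ (fun v w => ~ Q v w) inj _ Pd.
move=> /(_ _)/definable_not H.
apply: eq_definable (H _) => [v|v w]; last by rewrite PQ.
split=> [nex w|QA [w]]; last exact.
by apply: contrapT => nQ; apply: nex; exists w.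
Qed.

Definition set1v (i : nat) (v : nat -> R) x := override [:: i] v (fun=> x).

Lemma definable_ex1 i P (Q : (nat -> R) -> R -> Prop) :
  (forall v x, P (set1v i v x) <-> Q v x) ->
  definable P -> definable (fun v => exists x, Q v x).
Proof.
move=> PQ /(definable_exists [:: i]); apply: eq_definable => v; split.
  move=> [w Pw]; exists (w i); apply/PQ; congr (P _): Pw.
  by apply/funext => j; rewrite /set1v /override inE; case: eqP => [->|].
by move=> [x /PQ Px]; exists (fun=> x).
Qed.

Lemma definable_fa1 i P (Q : (nat -> R) -> R -> Prop) :
  (forall v x, P (set1v i v x) <-> Q v x) ->
  definable P -> definable (fun v => forall x, Q v x).
Proof.
move=> PQ /definable_not Pd.
have := @definable_ex1 i _ (fun v x => ~ Q v x) _ Pd.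
move=> /(_ _)/definable_not H.
apply: eq_definable (H _) => [v|v x]; last by rewrite PQ.
split=> [nex w|QA [w]]; last exact.
by apply: contrapT => nQ; apply: nex; exists w.
Qed.
End DefinableFamilies.

(** * Supersolutions and least supersolutions, and their definability *)

Section Polymap.
Variables (R : rcfType) (n k : nat) (A : tensor R n k).

Definition polymap (x : 'I_n -> R) (i : 'I_n) : R :=
  \sum_(t : k.-tuple 'I_n) A i t * \prod_(j < k) x (tnth t j).

(* By homogeneity, a gap of [1] is no stronger than a strict inequality. *)
Definition super (c : R) (w : 'I_n -> R) :=
  forall i, 0 <= w i /\ polymap w i + 1 <= c * w i ^+ k.

Definition least (c : R) (w : 'I_n -> R) :=
  super c w /\ forall w', super c w' -> forall i, w i <= w' i.

(* [w i / \sum_j w j <= s] for the least [w], stated without division so as to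
   be definable. *)
Definition share_le (i : 'I_n) (c s : R) :=
  exists w, least c w /\ w i <= s * \sum_j w j.

(* Variables 0, 1, 2 hold scalars (usually [c], a bound, and a radius); [W] and
   [W'] are two disjoint blocks of variables holding vectors. *)
Let W (i : 'I_n) := i.+3.
Let W' (i : 'I_n) := (n + i).+3.
Let Winj : injective W. Proof. by move=> i j [] /val_inj. Qed.
Let W'inj : injective W'. Proof. by move=> i j [] /addnI/val_inj. Qed.

Lemma definable_super (off : 'I_n -> nat) :
  definable (fun v : nat -> R => super (v 0) (fun i => v (off i))).
Proof.
apply: definable_all => i; apply: definable_and; apply: definable_le.
- exact: termfun_const.
- exact: termfun_var.
- apply: termfunD; last exact: termfun_const.
  apply: termfun_sum => t; apply: termfunM; first exact: termfun_const.
  by apply: termfun_prod => j; apply: termfun_var.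
- by apply: termfunM; [|apply: termfunX]; apply: termfun_var.
Qed.

Lemma definable_ex_super :
  definable (fun v : nat -> R => exists w, super (v 0) w).
Proof.
apply: definable_ex Winj _ (definable_super W) => v w.
by rewrite assignK // assign_out.
Qed.

Lemma definable_super_le (i : 'I_n) :
  definable (fun v : nat -> R => exists w, super (v 0) w /\ w i <= v 1).
Proof.
apply: (@definable_ex _ _ W (fun v =>
  super (v 0) (fun i => v (W i)) /\ v (W i) <= v 1)) => //.
  by move=> v w; rewrite assignK // assign_in // !assign_out.
apply: definable_and; first exact: definable_super.
by apply: definable_le; apply: termfun_var.
Qed.

Lemma definable_least :
  definable (fun v : nat -> R => least (v 0) (fun i => v (W i))).
Proof.
apply: definable_and; first exact: definable_super.
apply: (@definable_fa _ _ W' (fun v => super (v 0) (fun i => v (W' i)) ->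
   forall i, v (W i) <= v (W' i))) => //.
  move=> v w; rewrite assignK // !assign_out //.
  have E i : assign W' v w (W i) = v (W i).
    apply: assign_out => j; apply/eqP; rewrite /W /W'; have := ltn_ord i; lia.
  by split=> H sup i; have := H sup i; rewrite E assign_in.
apply: definable_imp; first exact: definable_super.
by apply: definable_all => i; apply: definable_le; apply: termfun_var.
Qed.

Lemma definable_share_le i :
  definable (fun v : nat -> R => share_le i (v 0) (v 1)).
Proof.
apply: (@definable_ex _ _ W (fun v =>
  least (v 0) (fun i => v (W i)) /\ v (W i) <= v 1 * \sum_j v (W j))) => //.
  move=> v w; rewrite assignK // assign_in // !assign_out //.
  by under eq_bigr do rewrite assign_in //.
apply: definable_and; first exact: definable_least.
apply: definable_le; first exact: termfun_var.
apply: termfunM; first exact: termfun_var.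
by apply: termfun_sum => j; apply: termfun_var.
Qed.

Lemma definable_eventually_share_le i r : definable (fun v : nat -> R =>
  exists d, 0 < d /\ forall c, r < c /\ c < r + d -> share_le i c (v 1)).
Proof.
apply: (@definable_ex1 _ 2 (fun v => 0 < v 2 /\
  forall c, r < c /\ c < r + v 2 -> share_le i c (v 1))) => //.
apply: definable_and.
  by apply: definable_lt; [apply: termfun_const|apply: termfun_var].
apply: (@definable_fa1 _ 0 (fun v =>
  r < v 0 /\ v 0 < r + v 2 -> share_le i (v 0) (v 1))) => //.
apply: definable_imp; last exact: definable_share_le.
apply: definable_and; apply: definable_lt; try exact: termfun_var.
  exact: termfun_const.
by apply: termfunD; [apply: termfun_const|apply: termfun_var].
Qed.

Lemma tame_ex_super : tame (fun c => exists w, super c w).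
Proof. exact: tame_definable 0 [::] definable_ex_super. Qed.

Lemma tame_super_le c i : tame (fun t => exists w, super c w /\ w i <= t).
Proof. exact: tame_definable 1 [:: c] (definable_super_le i). Qed.

Lemma tame_share_le s i : tame (fun c => share_le i c s).
Proof. exact: tame_definable 0 [:: 0; s] (definable_share_le i). Qed.

Lemma tame_eventually_share_le r i : tame (fun s =>
  exists d, 0 < d /\ forall c, r < c /\ c < r + d -> share_le i c s).
Proof. exact: tame_definable 1 [::] (definable_eventually_share_le i r). Qed.
End Polymap.

(** * Limits from the right at [r] *)

Section RightLimits.
Variables (R : rcfType) (r : R).
Implicit Types (P Q : R -> Prop) (f g : R -> R).

(** Written with the same conjunctions as [tame_eventually_share_le], so that the latter applies by
    conversion. *)
Definition evr P := exists d, 0 < d /\ forall c, r < c /\ c < r + d -> P c.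

Lemma evr_and P Q : evr P -> evr Q -> evr (fun c => P c /\ Q c).
Proof.
move=> [d [d0 dP]] [e [e0 eQ]]; exists (Num.min d e).
rewrite lt_min d0 e0; split=> //.
move=> c [rc]; rewrite -ltrBlDl lt_min => /andP[cd ce].
by split; [apply: dP|apply: eQ]; rewrite -ltrBlDl.
Qed.

Lemma evrW P Q : (forall c, r < c -> P c -> Q c) -> evr P -> evr Q.
Proof.
move=> PQ [d [d0 dP]]; exists d; split=> // c cd.
by apply: PQ (dP c cd); case: cd.
Qed.

Lemma evr_gt P : (forall c, r < c -> P c) -> evr P.
Proof. by move=> H; exists 1; split=> // c [/H]. Qed.

Lemma evr_ex P : evr P -> exists2 c, r < c & P c.
Proof. by move=> [d [d0 dP]]; exists (r + d / 2); [|apply: dP; split]; lra. Qed.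

Lemma evr_all (I : finType) (P : I -> R -> Prop) :
  (forall i, evr (P i)) -> evr (fun c => forall i, P i c).
Proof.
move=> H; suff gen (s : seq I) : evr (fun c => forall i, i \in s -> P i c).
  by apply: evrW (gen (enum I)) => c _ Pc i; apply: Pc; rewrite mem_enum.
elim: s => [|i s IHs]; first exact: evr_gt.
apply: evrW (evr_and (H i) IHs) => c _ [Pi Ps] j.
by rewrite inE => /predU1P[->|/Ps].
Qed.

Definition limr f l := forall e, 0 < e -> evr (fun c => `|f c - l| < e).

Lemma limr_const l : limr (fun=> l) l.
Proof. by move=> e e0; apply: evr_gt => c _; rewrite subrr normr0. Qed.

Lemma limr_id : limr id r.
Proof.
move=> e e0; exists e; split=> // c [rc cre].
by rewrite ger0_norm ?subr_ge0 ?ltW // ltrBlDl.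
Qed.

Lemma limrD f g l m : limr f l -> limr g m -> limr (fun c => f c + g c) (l + m).
Proof.
move=> fl gm e e0; have e20 : 0 < e / 2 by lra.
apply: evrW (evr_and (fl _ e20) (gm _ e20)) => c _ [fc gc].
rewrite opprD addrACA (le_lt_trans (ler_normD _ _)) // [e]splitr.
exact: ltrD.
Qed.

Lemma limrM f g l m : limr f l -> limr g m -> limr (fun c => f c * g c) (l * m).
Proof.
move=> fl gm e e0.
have m0 : 0 < `|m| + 1 by rewrite ltr_wpDl.
have l0 : 0 < `|l| + 1 by rewrite ltr_wpDl.
have e1 : 0 < e / 2 / (`|m| + 1) by rewrite !divr_gt0.
have e2 : 0 < e / 2 / (`|l| + 1) by rewrite !divr_gt0.
apply: evrW (evr_and (fl _ e1) (evr_and (gm _ e2) (gm _ ltr01)))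
  => c _ [fc [gc g1]].
have -> : f c * g c - l * m = (f c - l) * g c + l * (g c - m) by ring.
rewrite (le_lt_trans (ler_normD _ _)) // !normrM [e]splitr.
have gm1 : `|g c| <= `|m| + 1.
  have -> : g c = m + (g c - m) by ring.
  by rewrite (le_trans (ler_normD _ _)) // lerD2l ltW.
apply: ltr_leD.
  rewrite (le_lt_trans (ler_wpM2l _ gm1)) //.
  by rewrite -ltr_pdivlMr.
have l1 : `|l| <= `|l| + 1 by rewrite lerDl.
rewrite (le_trans (ler_wpM2r _ l1)) // mulrC -ler_pdivlMr //; exact: ltW.
Qed.

Lemma limrX f l n : limr f l -> limr (fun c => f c ^+ n) (l ^+ n).
Proof.
move=> fl; elim: n => [|n IHn]; first exact: limr_const.
by rewrite exprS => e e0; apply: evrW (limrM fl IHn e0) => c _; rewrite exprS.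
Qed.

Lemma limr_sum (I : Type) (s : seq I) (f : I -> R -> R) l :
  (forall i, limr (f i) (l i)) ->
  limr (fun c => \sum_(i <- s) f i c) (\sum_(i <- s) l i).
Proof.
move=> fl; elim: s => [|i s IHs].
  rewrite big_nil => e e0; apply: evrW (limr_const 0 e0) => c _.
  by rewrite big_nil.
rewrite big_cons => e e0; apply: evrW (limrD (fl i) IHs e0) => c _.
by rewrite big_cons.
Qed.

Lemma limr_prod (I : Type) (s : seq I) (f : I -> R -> R) l :
  (forall i, limr (f i) (l i)) ->
  limr (fun c => \prod_(i <- s) f i c) (\prod_(i <- s) l i).
Proof.
move=> fl; elim: s => [|i s IHs].
  rewrite big_nil => e e0; apply: evrW (limr_const 1 e0) => c _.
  by rewrite big_nil.
rewrite big_cons => e e0; apply: evrW (limrM (fl i) IHs e0) => c _.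
by rewrite big_cons.
Qed.

Lemma limr_unique f g l m : limr f l -> limr g m ->
  (forall c, r < c -> f c = g c) -> l = m.
Proof.
move=> fl gm fg; apply/eqP; rewrite -subr_eq0 -normr_le0 leNgt.
apply/negP => lm.
have e0 : 0 < `|l - m| / 2 by lra.
have [c rc [fc gc]] := evr_ex (evr_and (fl _ e0) (gm _ e0)).
have := ler_distD (f c) l m; rewrite distrC in fc; rewrite -fg // in gc; lra.
Qed.

Lemma limr_ge f l a : limr f l -> evr (fun c => a <= f c) -> a <= l.
Proof.
move=> fl af; rewrite leNgt; apply/negP => la.
have e0 : 0 < a - l by rewrite subr_gt0.
have [c _ [fc ac]] := evr_ex (evr_and (fl _ e0) af).
have := le_lt_trans (ler_norm _) fc; rewrite ltrD2r ltNge ac //.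
Qed.

(** [D s c] is a definable form of [f c <= s]. The limit is the cut of the set of eventual upper
    bounds [s]. *)
Lemma limr_tame f (D : R -> R -> Prop) :
  (forall c, r < c -> 0 <= f c <= 1) ->
  (forall s c, r < c -> D s c <-> f c <= s) ->
  (forall s, tame (D s)) ->
  tame (fun s => evr (D s)) -> exists l, limr f l.
Proof.
move=> f01 DP tc ts.
have [l [lu ll]] : exists m, (forall t, m < t -> evr (D t)) /\
    (forall t, t < m -> ~ evr (D t)).
  apply: tame_cut => // [a b ab||].
  - by apply: evrW => c rc; rewrite !DP // => /le_trans; apply.
  - exists (-1) => /evr_ex[c rc]; rewrite DP // => fc.
    by have /andP[] := f01 _ rc; lra.
  - by exists 1; apply: evr_gt => c rc; rewrite DP //; case/andP: (f01 _ rc).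
exists l => e e0.
have up : evr (D (l + e / 2)) by apply: lu; lra.
(* Below the cut the bound merely fails to hold eventually; tameness improves this to failing
   eventually. *)
have [[d d0 lo]|[d d0 lo]] := tame_eventually r (tc (l - e / 2)).
  by case: (ll (l - e / 2)); [lra|exists d; split=> // c /andP/lo].
have lo' : evr (fun c => ~ D (l - e / 2) c) by exists d; split=> // c /andP/lo.
apply: evrW (evr_and up lo') => c rc [].
rewrite !DP // => H1 /negP; rewrite -ltNge => H2.
rewrite ltr_norml; apply/andP; split; lra.
Qed.
End RightLimits.

(** * Perron-Frobenius theory of a nonnegative tensor *)

Section Tensor.
Variables (R : rcfType) (n k : nat) (A : tensor R n k).
Hypotheses (A_ge0 : forall i t, 0 <= A i t) (k_gt0 : (0 < k)%N).
Local Notation F := (polymap A).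
Implicit Types (x y z w v : 'I_n -> R) (i j : 'I_n).

Lemma polymap_ge0 x i : (forall j, 0 <= x j) -> 0 <= F x i.
Proof. by move=> x0; apply: sumr_ge0 => t _; rewrite mulr_ge0 // prodr_ge0. Qed.

Lemma polymap_le x y i : (forall j, 0 <= x j <= y j) -> F x i <= F y i.
Proof.
by move=> xy; apply: ler_sum => t _; rewrite ler_wpM2l // ler_prod.
Qed.

Lemma polymap_scale a x i : F (fun j => a * x j) i = a ^+ k * F x i.
Proof.
rewrite /polymap mulr_sumr; apply: eq_bigr => t _.
by rewrite big_split /= prodr_const card_ord mulrCA.
Qed.

(** [t] is the largest ratio [z i / w i]. Where [w] vanishes so does [z], and the ratio is zero. *)
Lemma touching z w : (forall i, 0 <= z i) -> (exists i, z i != 0) ->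
  (forall i, 0 <= w i) -> (forall i, z i != 0 -> 0 < w i) ->
  exists t i, [/\ 0 < t, z i = t * w i, 0 < z i & forall j, z j <= t * w j].
Proof.
move=> z0 [i1 zi1] w0 wpos.
have [i _ imax] := @arg_maxP _ _ _ i1 xpredT (fun i => z i / w i) isT.
have wi1 := wpos _ zi1.
have t0 : 0 < z i / w i.
  by apply: lt_le_trans (imax i1 isT); rewrite divr_gt0 // lt_def zi1 z0.
have wi : w i != 0 by apply: contraTneq t0 => ->; rewrite invr0 mulr0 ltxx.
exists (z i / w i), i; rewrite divfK //; split=> //.
  by rewrite lt_def z0 andbT; apply: contraTneq t0 => ->; rewrite mul0r ltxx.
move=> j; have [->|zj] := eqVneq (z j) 0; first exact: mulr_ge0 (ltW t0) (w0 j).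
by rewrite -ler_pdivrMr ?wpos //; apply: imax.
Qed.

(** At an index [i] where [t * w] touches [z] from above, monotonicity gives [c * z i ^+ k <= F z i
    <= t ^+ k * F w i < c' * z i ^+ k]. *)
Lemma sub_lt_super z (c : R) w (c' : R) :
  (forall i, 0 <= z i) -> (exists i, z i != 0) ->
  (forall i, c * z i ^+ k <= F z i) ->
  (forall i, 0 < w i) -> (forall i, F w i < c' * w i ^+ k) -> c < c'.
Proof.
move=> z0 zn0 sub w0 sup.
have [||t [i [t0 zi zi0 tz]]] := @touching z w z0 zn0 => // [j|].
  exact: ltW.
rewrite -(ltr_pM2r (exprn_gt0 k zi0)) (le_lt_trans (sub i)) //.
apply: (@le_lt_trans _ _ (F (fun j => t * w j) i)).
  by apply: polymap_le => j; rewrite z0 tz.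
by rewrite polymap_scale zi exprMn mulrCA ltr_pM2l ?exprn_gt0.
Qed.

Lemma super_gt0 c w : super A c w -> forall i, 0 < c * w i ^+ k.
Proof.
move=> sup i; have [_] := sup i; apply: lt_le_trans.
by rewrite ltr_wpDl // polymap_ge0 // => j; case: (sup j).
Qed.

Lemma super_pos c w : super A c w -> forall i, 0 < w i.
Proof.
move=> sup i; have [wi _] := sup i; rewrite lt_def wi andbT.
apply: contraTneq (super_gt0 sup i) => ->.
by rewrite expr0n eqn0Ngt k_gt0 mulr0 ltxx.
Qed.

Lemma super_c_gt0 c w i : super A c w -> 0 < c.
Proof.
move=> sup; have := super_gt0 sup i.
by rewrite pmulr_lgt0 // exprn_gt0 // (super_pos sup).
Qed.

Lemma super_mono c c' w : c <= c' -> super A c w -> super A c' w.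
Proof.
move=> cc sup i; have [w0 H] := sup i; split=> //; apply: le_trans H _.
by rewrite ler_wpM2r // exprn_ge0.
Qed.

Lemma root_exists (a : R) : 0 < a -> exists2 u : R, 0 < u & u ^+ k = a.
Proof.
by move=> a0; have [u u0] := nth_root k.-1 a0; rewrite prednK //; exists u.
Qed.

(* Knaster-Tarski: the entrywise infimum of all supersolutions. *)
Lemma least_exists c : (exists w, super A c w) ->
  exists w, least A c w /\ forall i, F w i + 1 = c * w i ^+ k.
Proof.
move=> exw.
have cuts i : exists m,
    (forall t, m < t -> exists w, super A c w /\ w i <= t) /\
    (forall t, t < m -> ~ exists w, super A c w /\ w i <= t).
  apply: tame_cut (tame_super_le A c i) _ _ _ => [a b ab [w [sw wa]]||].
  - by exists w; split=> //; apply: le_trans ab.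
  - exists (-1) => -[w [sw wi]]; have := super_pos sw i; lra.
  - by have [w sw] := exw; exists (w i), w.
have [w wP] := choice cuts.
have wle w' i : super A c w' -> w i <= w' i.
  move=> sw'; rewrite leNgt; apply/negP => /(proj2 (wP i)); apply.
  by exists w'.
have w0 i : 0 <= w i.
  rewrite leNgt; apply/negP => wi.
  have [|w' [sw' w'i]] := proj1 (wP i) (w i / 2); first lra.
  by have := super_pos sw' i; lra.
have wsup : super A c w.
  move=> i; split=> //; rewrite leNgt; apply/negP => lt.
  have c0 : 0 < c by have [w' /(super_c_gt0 i)] := exw.
  have Fw0 : 0 < F w i + 1 by rewrite ltr_wpDl // polymap_ge0.
  (* [u] is the value solving equation [i] exactly. Every supersolution dominates [w], so its entry
     at [i] is at least [u], yet some supersolution has an entry below the midpoint of [w i] and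
     [u]. *)
  have [u u0 uE] := root_exists (divr_gt0 Fw0 c0).
  have uE' : c * u ^+ k = F w i + 1 by rewrite uE mulrC divfK // gt_eqF // c0.
  have wu : w i < u.
    by move: lt; rewrite -uE' ltr_pM2l ?c0 // ltr_pXn2r ?nnegrE ?w0 ?(ltW u0).
  have [|w' [sw' w'i]] := proj1 (wP i) ((w i + u) / 2); first lra.
  have [w'0 H] := sw' i.
  have : F w i + 1 <= c * w' i ^+ k.
    by apply: le_trans H; rewrite lerD2r polymap_le // => j; rewrite w0 wle.
  rewrite -uE' ler_pM2l ?c0 // ler_pXn2r ?nnegrE ?w'0 ?(ltW u0) //; lra.
exists w; split=> [|i]; first by split=> // w' sw' i; apply: wle.
apply/eqP; rewrite eq_le; have [_ -> /=] := wsup i.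
rewrite leNgt; apply/negP => lt.
have c0 : 0 < c by have [w' /(super_c_gt0 i)] := exw.
have Fw0 : 0 < F w i + 1 by rewrite ltr_wpDl // polymap_ge0.
have [u u0 uE] := root_exists (divr_gt0 Fw0 c0).
have uE' : c * u ^+ k = F w i + 1 by rewrite uE mulrC divfK // gt_eqF // c0.
have uw : u < w i.
  by move: lt; rewrite -uE' ltr_pM2l ?c0 // ltr_pXn2r ?nnegrE ?w0 ?(ltW u0).
(* Lowering only the slack coordinate keeps a supersolution, since [F] can only decrease; this
   contradicts minimality. *)
pose w' j := if j == i then u else w j.
have w'w j : 0 <= w' j <= w j.
  by rewrite /w'; case: eqP => [->|]; rewrite ?w0 ?lexx // !ltW.
have /(wle w' i) : super A c w'.
  move=> j; have /andP[w'0 _] := w'w j; split=> //.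
  apply: (@le_trans _ _ (F w j + 1)); first by rewrite lerD2r polymap_le.
  by rewrite /w'; case: eqP => [->|_]; [rewrite uE'|case: (wsup j)].
by rewrite /w' eqxx leNgt uw.
Qed.

Lemma limr_polymap r (x : R -> 'I_n -> R) v i :
  (forall j, limr r (fun c => x c j) (v j)) ->
  limr r (fun c => F (x c) i) (F v i).
Proof.
move=> xv; apply: limr_sum => t; apply: limrM; first exact: limr_const.
by apply: limr_prod => j; apply: xv.
Qed.

Lemma critical_value i0 : exists r : R, [/\ 0 <= r,
  forall c, r < c -> exists w, super A c w &
  forall c, c < r -> ~ exists w, super A c w].
Proof.
have [r [ru rl]] : exists r : R, (forall c, r < c -> exists w, super A c w) /\
    (forall c, c < r -> ~ exists w, super A c w).
  apply: tame_cut (tame_ex_super A) _ _ _ => [a b ab [w sw]||].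
  - by exists w; apply: super_mono sw.
  - by exists 0 => -[w /(super_c_gt0 i0)]; rewrite ltxx.
  (* For the constant vector 1, the sum of the left-hand sides over all rows bounds each of them. *)
  - exists (\sum_i (F (fun=> 1) i + 1)), (fun=> 1) => i; split=> //.
    rewrite expr1n mulr1 (bigD1 i) //= lerDl sumr_ge0 // => j _.
    by rewrite addr_ge0 // polymap_ge0.
exists r; split=> //; rewrite leNgt; apply/negP => r0.
have [|w /(super_c_gt0 i0)] := ru (r / 2); lra.
Qed.

(* Were the least solutions bounded near [r], doubling one would give a
   supersolution below [r]. *)
Lemma critical_unbounded r (w : R -> 'I_n -> R) M :
  (forall c, r < c -> super A c (w c)) ->
  (forall c, c < r -> ~ exists w, super A c w) ->
  0 < M -> evr r (fun c => M < \sum_j w c j).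
Proof.
move=> wsup nsup M0; have Mk := exprn_gt0 k M0.
(* Replacing [c] by [r - d] costs at most [2 * d * M ^+ k], which is one half; doubling the vector
   multiplies the remaining gap of one half by [2 ^+ k], hence by at least 2. *)
pose d := (4 * M ^+ k)^-1; have d0 : 0 < d by rewrite invr_gt0 mulr_gt0.
exists d; split=> // c [rc cd]; rewrite ltNge; apply/negP => wM.
apply: (nsup (r - d)); first lra.
exists (fun j => 2 * w c j) => i; have [w0 wi] := wsup c rc i.
split; first by rewrite mulr_ge0.
have wiM : w c i <= M.
  apply: le_trans wM; rewrite (bigD1 i) //= lerDl sumr_ge0 // => j _.
  by have [] := wsup c rc j.
have wk : w c i ^+ k <= M ^+ k by rewrite lerXn2r // nnegrE // ltW.
rewrite polymap_scale exprMn mulrCA.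
have k2 : 2 <= 2 ^+ k :> R.
  by rewrite -{1}[2]expr1 ler_weXn2l // ler1n.
have H : F (w c) i + 2^-1 <= (r - d) * w c i ^+ k.
  have E : d * M ^+ k = 4^-1 by rewrite /d; field; rewrite gt_eqF.
  have wk0 : 0 <= w c i ^+ k by rewrite exprn_ge0.
  have : (c - (r - d)) * w c i ^+ k <= 2 * d * M ^+ k.
    by apply: ler_pM => //; lra.
  rewrite -mulrA E mulrBl => H; lra.
have k20 : 0 <= 2 ^+ k :> R by apply: le_trans k2.
have := ler_wpM2l k20 H; rewrite mulrDr.
set a := _ * F _ _; set b := _ * (_ * _).
move: (2 ^+ k) k2 a b => p p2 a b; lra.
Qed.

(** The last clause keeps the positive strict supersolutions near [v]: [v] itself may have zero
    entries, and comparison and Harnack arguments need positivity. The index [i0] makes the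
    dimension positive. *)
Theorem collatz_wielandt i0 : exists (r : R) v, [/\ 0 <= r, forall i, 0 <= v i,
  exists i, v i != 0, forall i, F v i = r * v i ^+ k &
  (forall z (c : R), (forall i, 0 <= z i) -> (exists i, z i != 0) ->
     (forall i, c * z i ^+ k <= F z i) -> c <= r) /\
  forall e : R, 0 < e -> exists c w, [/\ r < c < r + e, forall i, 0 < w i,
     forall i, F w i < c * w i ^+ k & forall i, `|w i - v i| < e]].
Proof.
have [r [r0 ru rl]] := critical_value i0.
have /choice[w wP] : forall c, exists w, r < c ->
    least A c w /\ forall i, F w i + 1 = c * w i ^+ k.
  move=> c; have [/ru/(least_exists)[w]|_] := ltP r c; first by exists w.
  (* A default value; only [c > r] matters. *)
  by exists (fun=> 0).
have wsup c : r < c -> super A c (w c) by move=> /wP[[]].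
have wpos c i : r < c -> 0 < w c i by move=> /wsup/(super_pos).
pose S c := \sum_j w c j.
have Sge c i : r < c -> w c i <= S c.
  move=> rc; rewrite /S (bigD1 i) //= lerDl sumr_ge0 // => j _.
  by rewrite ltW // wpos.
have Spos c : r < c -> 0 < S c.
  by move=> rc; apply: lt_le_trans (Sge c i0 rc); apply: wpos.
pose x c i := w c i / S c.
have xpos c i : r < c -> 0 < x c i by move=> rc; rewrite divr_gt0 ?wpos ?Spos.
(* The shares lie in [[0, 1]] and, the least solution being unique, [share_le] defines their
   comparison with [s]. *)
have /choice[v xv] : forall i, exists l, limr r (fun c => x c i) l.
  move=> i; apply: (@limr_tame _ r _ (fun s c => share_le A i c s)).
  - move=> c rc; rewrite ltW ?xpos //= ler_pdivrMr ?Spos // mul1r; exact: Sge.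
  - move=> s c rc; rewrite /x ler_pdivrMr ?Spos //; have [[_ lw] _] := wP c rc.
    split=> [[u [[su lu] H]]|H]; last first.
      by exists (w c); split=> //; case: (wP c rc).
    suff E : w c = u by rewrite /S E.
    apply/funext => j; apply/le_anti; rewrite lw // lu //; exact: wsup.
  - by move=> s; apply: tame_share_le.
  - exact: tame_eventually_share_le.
have Fx c i : r < c -> F (x c) i + (S c)^-1 ^+ k = c * x c i ^+ k.
  move=> rc; have [_ /(_ i) Fw] := wP c rc.
  have -> : x c = fun j => (S c)^-1 * w c j.
    by apply/funext => j; rewrite /x mulrC.
  by rewrite polymap_scale exprMn mulrCA -Fw mulrDr mulr1.
have Sinv : limr r (fun c => (S c)^-1 ^+ k) 0.
  suff : limr r (fun c => (S c)^-1) 0.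
    by move=> /(limrX k); rewrite expr0n eqn0Ngt k_gt0.
  move=> e e0; have ie0 : 0 < e^-1 by rewrite invr_gt0.
  apply: evrW (critical_unbounded wsup rl ie0) => c rc Se.
  rewrite subr0 ger0_norm ?invr_ge0 ?ltW ?Spos //.
  by rewrite invf_plt ?posrE ?Spos.
have Fv i : F v i = r * v i ^+ k.
  rewrite -[LHS]addr0; apply: limr_unique (Fx ^~ i).
    by apply: limrD Sinv; apply: limr_polymap.
  by apply: limrM; [exact: limr_id|exact: limrX].
have v0 i : 0 <= v i.
  by apply: limr_ge (xv i) _; apply: evr_gt => c rc; rewrite ltW ?xpos.
(* The normalization passes to the limit and keeps [v] from being zero. *)
have Sv : \sum_i v i = 1.
  apply: limr_unique (limr_sum _ xv) (limr_const r 1) _ => c rc.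
  by rewrite -mulr_suml divff // gt_eqF ?Spos.
have approx e : 0 < e -> exists c w, [/\ r < c < r + e, forall i, 0 < w i,
     forall i, F w i < c * w i ^+ k & forall i, `|w i - v i| < e].
  move=> e0.
  have close : evr r (fun c => c < r + e) by exists e; split=> // c [].
  have [c rc [cre xe]] := evr_ex (evr_and close (evr_all (fun i => xv i e e0))).
  exists c, (x c); rewrite rc cre; split=> // i; first exact: xpos.
  by rewrite -Fx // ltrDl exprn_gt0 // invr_gt0 Spos.
exists r, v; split=> //.
  apply: contrapT => nv; have : (1 : R) != 0 by rewrite oner_eq0.
  rewrite -Sv big1 ?eqxx // => i _; apply/eqP/negPn/negP => vi.
  by apply: nv; exists i.
split=> // z c z0 zn0 zsub; rewrite leNgt; apply/negP => rc.
have [|c' [y [/andP[_ c'c] y0 ysup _]]] := approx (c - r); first lra.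
have := sub_lt_super z0 zn0 zsub y0 ysup; lra.
Qed.
End Tensor.

(** * The adjacency tensor, the core and the support of a Perron eigenvector *)

Lemma connect_invariant (T : finType) (e : rel T) (P : T -> Prop) a b :
  (forall x y, e x y -> P x -> P y) -> connect e a b -> P a -> P b.
Proof.
move=> eP /connectP[p]; elim: p a => [|y p IHp] a /= => [_ -> //|].
move=> /andP[ay pp] bE Pa.
exact: IHp pp bE (eP _ _ ay Pa).
Qed.

Section Core.
Variables (R : rcfType) (n k : nat) (G : rel 'I_n) (K : {set 'I_n}).
Hypotheses (G_irr : irreflexive G) (k_gt0 : (0 < k)%N).
Hypothesis K_deg : min_deg_ge G k K.
Implicit Types (x y z w v : 'I_n -> R) (i j : 'I_n).

(** A copy of [kadj_tensor], whose scalars must be algebraically closed, over a real closed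
    field. *)
Definition real_kadj : tensor R n k := fun i t =>
  if uniq (i :: val t) && all (fun j => j \in nbhd G i) (val t)
  then (k`!%:R)^-1 else 0.

(* Restricting the tensor to [K] keeps the index set ['I_n]: the rows outside
   [K] are set to zero. *)
Definition core_kadj : tensor R n k := fun i t =>
  if (i \in K) && all (mem K) (val t) then real_kadj i t else 0.

Lemma real_kadj_ge0 i t : 0 <= real_kadj i t.
Proof. by rewrite /real_kadj; case: ifP; rewrite ?invr_ge0 ?ler0n. Qed.

Lemma core_kadj_ge0 i t : 0 <= core_kadj i t.
Proof. by rewrite /core_kadj; case: ifP; rewrite ?real_kadj_ge0. Qed.

Lemma core_kadj_le i t : core_kadj i t <= real_kadj i t.
Proof. by rewrite /core_kadj; case: ifP; rewrite ?real_kadj_ge0. Qed.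

(** List the neighbors of [i] in [K], at least [k] in number, with [j] first, and keep the first
    [k]. *)
Lemma core_tuple i j : i \in K -> j \in K -> G i j ->
  exists2 t : k.-tuple 'I_n, core_kadj i t = (k`!%:R)^-1 &
    j \in val t /\ {subset val t <= K}.
Proof.
move=> iK jK Gij; pose N := nbhd G i :&: K.
have jN : j \in N by rewrite !inE Gij.
have kN : (k <= #|N|)%N by have /forall_inP/(_ _ iK) := K_deg.
pose s := j :: rem j (enum N).
have sE : perm_eq (enum N) s by rewrite perm_to_rem // mem_enum.
have szs : size (take k s) == k.
  by rewrite size_takel // -(perm_size sE) -cardE.
have sub l : l \in take k s -> l \in N.
  by move=> /mem_take; rewrite -(perm_mem sE) mem_enum.
exists (Tuple szs); rewrite /core_kadj /real_kadj /=; last first.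
  split; last by move=> l /sub; rewrite inE => /andP[].
  by rewrite -(prednK k_gt0) /= mem_head.
have -> : all (mem K) (take k s).
  by apply/allP => l /sub; rewrite inE => /andP[].
have -> : all (fun j => j \in nbhd G i) (take k s).
  by apply/allP => l /sub; rewrite inE => /andP[].
rewrite iK take_uniq -?(perm_uniq sE) ?enum_uniq // !andbT.
by case: ifP => // /negbFE/sub; rewrite !inE G_irr.
Qed.

Lemma polymap_ge_term (A : tensor R n k) x i t : (forall i t, 0 <= A i t) ->
  (forall j, 0 <= x j) -> A i t * \prod_(j < k) x (tnth t j) <= polymap A x i.
Proof.
move=> A0 x0; rewrite /polymap (bigD1 t) //= lerDl sumr_ge0 // => u _.
by rewrite mulr_ge0 // prodr_ge0.
Qed.

Lemma core_neighbor i : i \in K -> exists2 j, j \in K & G i j.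
Proof.
move=> iK; have /forall_inP/(_ _ iK) kN := K_deg.
have /card_gt0P[j] : (0 < #|nbhd G i :&: K|)%N by apply: leq_trans kN.
by rewrite !inE => /andP[Gij jK]; exists j.
Qed.

(** On the core a single tuple of neighbors already contributes the required term. This bounds the
    spectral radius below by [1 / k!]. *)
Lemma core_indicator i (x := fun j => (j \in K)%:R : R) :
  (k`!%:R)^-1 * x i ^+ k <= polymap real_kadj x i.
Proof.
have x0 j : 0 <= x j by rewrite ler0n.
rewrite [x i]/x.
have [iK|_] := boolP (i \in K); last first.
  by rewrite expr0n eqn0Ngt k_gt0 mulr0 polymap_ge0 //; apply: real_kadj_ge0.
have [j jK Gij] := core_neighbor iK.
have [t tE [_ tK]] := core_tuple iK jK Gij.
apply: le_trans (polymap_ge_term i t real_kadj_ge0 x0).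
rewrite expr1n mulr1 big1 ?mulr1; last by move=> l _; rewrite /x tK ?mem_tnth.
by rewrite -tE core_kadj_le.
Qed.

(** At a support vertex some term of the sum is nonzero; its [k] distinct indices are neighbors
    lying in the support. *)
Lemma supp_min_deg x r : r != 0 ->
  (forall i, polymap real_kadj x i = r * x i ^+ k) ->
  min_deg_ge G k [set i | x i != 0].
Proof.
move=> r0 xE; apply/forall_inP => i; rewrite inE => xi.
have : polymap real_kadj x i != 0 by rewrite xE mulf_neq0 // expf_neq0.
have [/existsP[t]|/existsPn nt] := boolP [exists t : k.-tuple 'I_n,
    real_kadj i t * \prod_(j < k) x (tnth t j) != 0]; last first.
  by rewrite /polymap big1 ?eqxx // => t _; apply/eqP/negPn.
rewrite mulf_eq0 negb_or /real_kadj => /andP[].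
case: ifP => [|]; last by rewrite eqxx.
move=> /andP[/= /andP[_ ut] /allP tN] _ /prodf_neq0 tx _.
rewrite cardE -{1}(size_tuple t) uniq_leq_size // => j jt.
rewrite mem_enum !inE; have := tN j jt; rewrite inE => -> /=.
by have /tnthP[l ->] := jt; apply: tx.
Qed.

Lemma core_supported v r : r != 0 ->
  (forall i, polymap core_kadj v i = r * v i ^+ k) ->
  forall i, v i != 0 -> i \in K.
Proof.
move=> r0 vE i; apply: contraR => iK.
have := vE i; rewrite /polymap big1 => [/esym/eqP|t _].
  by rewrite mulf_eq0 (negbTE r0) expf_eq0 k_gt0.
by rewrite /core_kadj (negbTE iK) mul0r.
Qed.

(** Each term dropped from a row in [K] contains a factor [x l] with [l] outside [K], which is
    zero. *)
Lemma core_polymap_supported x r : (forall i, x i != 0 -> i \in K) ->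
  (forall i, polymap real_kadj x i = r * x i ^+ k) ->
  forall i, polymap core_kadj x i = r * x i ^+ k.
Proof.
move=> xK xE i; have [iK|iK] := boolP (i \in K); last first.
  rewrite /polymap big1 => [|t _]; last by rewrite /core_kadj (negbTE iK) mul0r.
  have /eqP -> : x i == 0 by apply: contraR iK => /xK.
  by rewrite expr0n eqn0Ngt k_gt0 mulr0.
rewrite -xE; apply: eq_bigr => t _; rewrite /core_kadj iK /=.
case: ifP => // /negbT/allPn[j /tnthP[l ->] jK].
have xl : x (tnth t l) = 0 by apply/eqP; apply: contraR jK => /xK.
by rewrite (bigD1 l) //= xl !mul0r mulr0.
Qed.

Lemma prod_ge_factor (m : R) w (t : k.-tuple 'I_n) j : 0 <= m ->
  (forall l, l \in val t -> m <= w l) -> j \in val t ->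
  w j * m ^+ k.-1 <= \prod_(l < k) w (tnth t l).
Proof.
move=> m0 mw jt; have wj : 0 <= w j := le_trans m0 (mw j jt).
have /tnthP[l0 jE] := jt; rewrite (bigD1 l0) //= jE ler_wpM2l -?jE //.
have -> : m ^+ k.-1 = \prod_(l < k | l != l0) m.
  by rewrite prodr_const (cardC1 l0) card_ord.
by apply: ler_prod => l _; rewrite m0 mw ?mem_tnth.
Qed.

(* Harnack inequality: the constant does not depend on the supersolution. *)
Lemma harnack (c0 : R) a b : induced_connected G K -> a \in K -> b \in K ->
  exists C : R, forall c w (m : R), c <= c0 -> (forall i, 0 < w i) ->
    (forall i, polymap core_kadj w i <= c * w i ^+ k) -> 0 < m ->
    (forall i, i \in K -> m <= w i) -> w a <= m -> w b <= C * m.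
Proof.
move=> conK aK bK.
pose P i := exists C : R, forall c w (m : R), c <= c0 -> (forall i, 0 < w i) ->
    (forall i, polymap core_kadj w i <= c * w i ^+ k) -> 0 < m ->
    (forall i, i \in K -> m <= w i) -> w a <= m -> w i <= C * m.
apply: (connect_invariant (P := P) _ (conK a b aK bK)); last first.
  by exists 1 => c w m *; rewrite mul1r.
move=> i j /and3P[Gij iK jK] [D DP].
have [t tE [jt tK]] := core_tuple iK jK Gij.
(* Row [i] has a term with the factor [w j] and all other factors at least [m], so
   [w j * m ^+ k.-1 / k!] is at most [c0 * (D * m) ^+ k]. *)
exists (k`!%:R * c0 * D ^+ k) => c w m cc0 w0 wsup m0 mw wa.
have wiD := DP c w m cc0 w0 wsup m0 mw wa.
have k0 : 0 < k`!%:R :> R by rewrite ltr0n fact_gt0.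
have wle l : 0 <= w l by rewrite ltW.
have mk : 0 < m ^+ k.-1 by rewrite exprn_gt0.
have c00 : 0 <= c0.
  apply: le_trans cc0; rewrite -(pmulr_lge0 c (exprn_gt0 k (w0 i))).
  by apply: le_trans (wsup i); apply: polymap_ge0 => //; apply: core_kadj_ge0.
have H1 : (k`!%:R)^-1 * (w j * m ^+ k.-1) <= c0 * (D * m) ^+ k.
  apply: (@le_trans _ _ (polymap core_kadj w i)).
    apply: le_trans (polymap_ge_term i t core_kadj_ge0 wle).
    rewrite tE ler_pM2l ?invr_gt0 //.
    apply: prod_ge_factor => //; first exact: ltW.
    by move=> l /tK/mw.
  apply: le_trans (wsup i) _; apply: ler_pM => //.
  - rewrite -(pmulr_lge0 c (exprn_gt0 k (w0 i))).
    by apply: le_trans (wsup i); apply: polymap_ge0 => //; apply: core_kadj_ge0.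
  - by rewrite exprn_ge0.
  - by rewrite lerXn2r // nnegrE // (le_trans (wle i)).
move: H1; rewrite ler_pdivrMl // exprMn -[in m ^+ k](prednK k_gt0) exprS !mulrA.
by rewrite ler_pM2r.
Qed.

Lemma prod_lt_factor x y (t : k.-tuple 'I_n) j : (forall l, 0 <= x l <= y l) ->
  (forall l, l \in val t -> 0 < y l) -> j \in val t -> x j < y j ->
  \prod_(l < k) x (tnth t l) < \prod_(l < k) y (tnth t l).
Proof.
move=> xy y0 jt xj; have /tnthP[l0 jE] := jt.
rewrite (bigD1 l0) //= [X in _ < X](bigD1 l0) //= -jE.
have le : \prod_(l < k | l != l0) x (tnth t l) <=
    \prod_(l < k | l != l0) y (tnth t l).
  exact: ler_prod.
apply: le_lt_trans (ler_wpM2l _ le) _; first by have /andP[] := xy j.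
by rewrite ltr_pM2r // prodr_gt0 // => l _; rewrite y0 ?mem_tnth.
Qed.

Local Notation A := real_kadj.
Local Notation B := core_kadj.

(** If [v] vanished at a core vertex, the approximating [w] would have a small minimum over the
    core. By Harnack [w l] would be small as well, although it is close to [v l > 0]. *)
Lemma core_limit_positive (r : R) v : induced_connected G K -> 0 < r ->
  (forall i, 0 <= v i) -> (exists i, v i != 0) ->
  (forall i, polymap B v i = r * v i ^+ k) ->
  (forall e : R, 0 < e -> exists (c : R) w,
    [/\ r < c < r + e, forall i, 0 < w i,
     forall i, polymap B w i < c * w i ^+ k & forall i, `|w i - v i| < e]) ->
  forall i, i \in K -> 0 < v i.
Proof.
move=> conK r0 v0 [l vl] vE approx j jK.
rewrite lt_def v0 andbT; apply/negP => /eqP vj.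
have lK := core_supported (lt0r_neq0 r0) vE vl.
have /choice[C CP] : forall a, exists C : R, a \in K -> forall c w (m : R),
    c <= r + 1 -> (forall i, 0 < w i) ->
    (forall i, polymap B w i <= c * w i ^+ k) -> 0 < m ->
    (forall i, i \in K -> m <= w i) -> w a <= m -> w l <= C * m.
  move=> a; have [aK|_] := boolP (a \in K); last by exists 0.
  have [C CP] := harnack (r + 1) conK aK lK.
  by exists C.
(* The minimizing vertex varies with [w]; [D] dominates the constants of all of them. *)
pose D := \sum_a `|C a|.
have D0 : 0 <= D by apply: sumr_ge0.
have vl0 : 0 < v l by rewrite lt_def vl v0.
(* The bound 1 keeps [c] below [r + 1]; the other one contradicts [v l < e + D * e]. *)
pose e := Num.min 1 (v l / (D + 1)).
have e0 : 0 < e by rewrite lt_min ltr01 divr_gt0 // ltr_wpDl.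
have [c [w [/andP[rc cr] w0 wsup wv]]] := approx e e0.
have [a aK amin] := arg_minP w jK.
have wj : w j < e by have := wv j; rewrite vj subr0 gtr0_norm.
have wl : w l <= C a * w a.
  apply: (CP a aK c w) => // [|i]; last exact: ltW.
  by rewrite (le_trans (ltW cr)) // lerD2l ge_min lexx.
have : v l < e * (D + 1).
  have H1 : v l - w l < e by apply: le_lt_trans (ler_norm _) _; rewrite distrC.
  suff : w l <= D * e by lra.
  apply: le_trans wl _; apply: (@le_trans _ _ (D * w a)).
    rewrite ler_pM2r // (le_trans (ler_norm _)) // /D (bigD1 a) //= lerDl.
    exact: sumr_ge0.
  by rewrite ler_wpM2l // ltW // (le_lt_trans (amin j jK)).
by rewrite -ltr_pdivrMr ?ltr_wpDl // ltNge ge_min lexx orbT.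
Qed.

(** A strict inequality at [b] would make the term of row [a] given by a core tuple through [b]
    strictly smaller, and no other term can compensate. *)
Lemma core_equality_spreads (t : R) x v a b : 0 < t ->
  (forall i, 0 <= x i <= t * v i) -> (forall i, i \in K -> 0 < v i) ->
  polymap B x a = t ^+ k * polymap B v a ->
  [&& G a b, a \in K & b \in K] -> x b = t * v b.
Proof.
move=> t0 xv v0; rewrite -polymap_scale => FE /and3P[Gab aK bK].
apply/eqP; rewrite eq_le; have /andP[_ ->] := xv b.
rewrite /= leNgt; apply/negP => lt.
have [u uE [bu uK]] := core_tuple aK bK Gab.
suff : polymap B x a < polymap B (fun j => t * v j) a by rewrite FE ltxx.
rewrite /polymap (bigD1 u) //= [X in _ < X](bigD1 u) //=; apply: ltr_leD.
  rewrite uE ltr_pM2l ?invr_gt0 ?ltr0n ?fact_gt0 //.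
  apply: (prod_lt_factor (y := fun j => t * v j) (j := b)) => // l /uK/v0 vl.
  by rewrite mulr_gt0.
apply: ler_sum => s _; rewrite ler_wpM2l ?core_kadj_ge0 //.
exact: ler_prod.
Qed.

Lemma perron_support (r : R) x : K != set0 ->
  (forall S : {set 'I_n}, min_deg_ge G k S -> S \subset K) ->
  (forall s v, (forall i, 0 <= v i) -> (exists i, v i != 0) ->
     (forall i, polymap A v i = s * v i ^+ k) -> s <= r) ->
  (forall i, 0 <= x i) -> (exists i, x i != 0) ->
  (forall i, polymap A x i = r * x i ^+ k) ->
  (forall i, x i != 0 -> i \in K) /\
  (induced_connected G K -> forall i, i \in K -> x i != 0).
Proof.
move=> /set0Pn[i0 i0K] K_max r_max x0 xn0 xE.
(* The value [s] produced for the full tensor bounds [c], and it has a nonnegative eigenvector, so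
   [r] bounds it. *)
have sub_le (c : R) z : (forall i, 0 <= z i) -> (exists i, z i != 0) ->
    (forall i, c * z i ^+ k <= polymap A z i) -> c <= r.
  move=> z0 zn0 zsub.
  have [s [v [_ v0 vn0 vE [smax _]]]] :=
    collatz_wielandt real_kadj_ge0 k_gt0 i0.
  exact: le_trans (smax z c z0 zn0 zsub) (r_max s v v0 vn0 vE).
have r0 : 0 < r.
  have k0 : 0 < (k`!%:R)^-1 :> R by rewrite invr_gt0 ltr0n fact_gt0.
  apply: lt_le_trans k0 (sub_le _ (fun j => (j \in K)%:R) _ _ _) => [i||i].
  - by rewrite ler0n.
  - by exists i0; rewrite i0K oner_eq0.
  - exact: core_indicator.
have xK i : x i != 0 -> i \in K.
  have /K_max/subsetP/(_ i) := supp_min_deg (lt0r_neq0 r0) xE.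
  by rewrite inE.
split=> // conK.
have [s [v [_ v0 vn0 vE [smax approx]]]] :=
  collatz_wielandt core_kadj_ge0 k_gt0 i0.
(* The core tensor has the same critical value [r]: its eigenvector [v] satisfies the subsolution
   inequality for the larger full tensor, and conversely [x], supported on [K], is an eigenvector of
   the core tensor. *)
have sr : s <= r.
  apply: (sub_le _ v) => // i; rewrite -vE; apply: ler_sum => t _.
  by rewrite ler_wpM2r ?core_kadj_le // prodr_ge0.
have xBE := core_polymap_supported xK xE.
have rs : r <= s by apply: (smax x) => // i; rewrite xBE.
have {}sr : s = r by apply/le_anti; rewrite sr rs.
subst s.
have vpos := core_limit_positive conK r0 v0 vn0 vE approx.
have [t [i [t0 xi xi0 xt]]] :=
  touching x0 xn0 v0 (fun i xi => vpos i (xK i xi)).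
move=> j jK; have iK : i \in K by rewrite xK // gt_eqF.
suff -> : x j = t * v j by rewrite gt_eqF // mulr_gt0 ?vpos.
apply: (connect_invariant (P := fun a => x a = t * v a) _ (conK i j iK jK))
  => // a b ab xa.
apply: core_equality_spreads ab => // [l|]; first by rewrite x0 xt.
by rewrite xBE xa exprMn vE mulrCA.
Qed.
End Core.

(** * Transfer from the real subfield to [C] *)

Lemma rval_polymap (C : numClosedFieldType) (n k : nat) (G : rel 'I_n)
    (x : 'I_n -> realsub C) i :
  rval (polymap (@real_kadj (realsub C : rcfType) n k G) x i) =
  tapply (@kadj_tensor C n G k) (fun j => rval (x j)) i.
Proof.
rewrite /polymap rmorph_sum; apply: eq_bigr => t _.
rewrite rmorphM rmorph_prod /=; congr (_ * _).
rewrite /real_kadj /kadj_tensor; case: ifP => // _.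
by rewrite fmorphV rmorph_nat.
Qed.

Theorem theorem3p2 (C : numClosedFieldType) (n : nat) (G : rel 'I_n) (k : nat)
  (K : {set 'I_n}) (rho : C) (x : 'I_n -> C) :
  simple_graph G -> (0 < k)%N ->
  is_kcore_vertex_set G k K -> K != set0 ->
  is_spectral_radius (@kadj_tensor C n G k) rho ->
  (forall i, 0 <= x i) ->
  is_eigenpair (@kadj_tensor C n G k) rho x ->
  supp x \subset K /\ (induced_connected G K -> supp x = K).
Proof.
move=> [_ G_irr] k_gt0 [K_deg K_max] K0 [[l0 [_ rhoE]] rho_max] x0 [xn0 xE].
have rhoR : rho \is Num.real by rewrite -rhoE normr_real.
pose r := RealSub rhoR; pose y i := RealSub (ger0_real (x0 i)).
have [||||ysub ycon] := @perron_support (realsub C : rcfType) n k G K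
  G_irr k_gt0 K_deg r y K0 K_max.
(* A real eigenvalue is at most its modulus, hence at most [rho]. *)
- move=> s v v0 [i vi] vE; rewrite -rval_le /=.
  apply: le_trans (rho_max (rval s) _); first exact: real_ler_norm (rvalP s).
  exists (fun i => rval (v i)); split; first by exists i.
  by move=> j; rewrite -rval_polymap vE rmorphM rmorphXn.
- exact: x0.
- by have [i xi] := xn0; exists i.
- move=> i; apply: val_inj; transitivity (rval (r * y i ^+ k)) => //.
  by rewrite rmorphM rmorphXn; apply: etrans (rval_polymap k G y i) (xE i).
split=> [|/ycon yK].
  by apply/subsetP => i; rewrite inE => xi; apply: ysub.
apply/setP => i; rewrite inE; apply/idP/idP => [|iK]; first exact: ysub.
exact: yK.
Qed.
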